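(* Let $G$ be a finite group and let $p$ be a prime number. If $x^Gy^G=(xy)^G$ for every $p$-element $x\in G$ and every $p'$-element $y\in G$ of prime power order, then $G$ is $p$-solvable.
   Context: For $g\in G$, $g^G$ denotes the conjugacy class of $g$ in $G$, and $x^Gy^G=\{uv : u\in x^G,\ v\in y^G\}$. A $p$-element is an element whose order is a power of $p$; a $p'$-element is an element whose order is not divisible by $p$. A finite group is $p$-solvable if each of its composition factors is either of order $p$ or of order not divisible by $p$. *)

(* Defs.v *)
From mathcomp Require Import all_boot all_fingroup all_solvable.

Set Implicit Arguments.
Unset Strict Implicit.
Unset Printing Implicit Defensive.

Local Open Scope group_scope.

(* The entries of [mkfactors G s] are canonical representatives of the
   isomorphism classes of the successive quotients of the composition series
   [s], so they have the same orders as the actual composition factors. *)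
Definition p_solvable (p : nat) (gT : finGroupType) (G : {group gT}) : Prop :=
  forall s : seq {group gT}, comps G s ->
  forall F : section gT, F \in mkfactors G s -> #|F| = p \/ ~~ (p %| #|F|).

Definition prime_power_order (gT : finGroupType) (y : gT) : Prop :=
  exists2 q : nat, prime q & q.-elt y.

(* Main.v *)
Require Import Defs.
From mathcomp Require Import all_boot all_fingroup all_solvable.
From mathcomp Require Import ssralg finalg.

(** Write [K_z] for the conjugacy class of [z] in [G]. The theorem rests on the
identity [[u, y^-1] * y = y ^ u]. Suppose that a p'-element [y] of prime power
order normalises a p-group [U], and that some [u] in [U] does not commute with
[y]. Then [x = [u, y^-1]] is a nontrivial element of [U] with [x * y] conjugate
to [y], so the hypothesis gives [K_x K_y = K_y]. Hence [K_y] is stable under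
multiplication by [K_x], and therefore by the normal closure [L] of [x]. If [y]
lies in [L], then [1 = y y^-1] lies in [K_y], which is absurd because [y] is
not [1].

Let [M] be a minimal normal subgroup of [G]. Applied to [x] and [y] in [M], for
which [L = M], this shows that every p'-element of prime power order of [M]
that normalises a p-subgroup of [M] centralises it. This is the hypothesis of
Frobenius' criterion for a normal p-complement. The only consequence of that
criterion used here is that such an [M] is not perfect if [p] divides its
order: Sylow p-subgroups [P] of [M] control fusion
([Sylow_controls_fusion]), so the transfer [M -> P / P'] sends each [g] in [P]
to the class of [g ^+ #|M : P|], which is nontrivial outside [P']. As the
derived subgroup of a minimal normal subgroup is [1] or everything, [M] is
abelian or a p'-group ([minnormal_abelian_or_p']).

The hypothesis passes to quotients, so the same holds for every chief factor of
[G]. A simple section [H / K] of [G] is a quotient of a subgroup of some chief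
factor ([simple_section_abelian_or_p']), so it is abelian or a p'-group; an
abelian simple group has prime order. *)

Set Implicit Arguments.
Unset Strict Implicit.
Unset Printing Implicit Defensive.

Local Open Scope group_scope.

(** * Frobenius' condition and control of fusion *)

(** Frobenius' condition that ['N_M(U) / 'C_M(U)] be a p-group for every
p-subgroup [U], tested only on elements of prime power order because these are
the ones that the hypothesis on class products speaks of. *)
Definition p_locally_central (p : nat) (gT : finGroupType) (M : {group gT}) :=
  forall (U : {group gT}) (y : gT), p.-group U -> U \subset M ->
    y \in 'N_M(U) -> p^'.-elt y -> prime_power_order y -> y \in 'C(U).

Section Fusion.

Variables (p : nat) (gT : finGroupType) (M : {group gT}).
Hypothesis Mloc : p_locally_central p M.

(** A prime [q <> p] dividing the order would give, by Cauchy, a nontrivial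
q-element of the quotient; the q-part of any lift of it is a p'-element of
prime power order normalising [U], hence centralises [U]. *)
Lemma pgroup_norm_cent_quotient (U : {group gT}) :
  p.-group U -> U \subset M -> p.-group ('N_M(U) / 'C_M(U)).
Proof.
move=> pU sUM; apply/pgroupP=> q q_pr.
case/(Cauchy q_pr)=> [zb /morphimP[z nCz Nz Dzb] oz].
have [<- | q'p] := eqVneq q p; first by rewrite !inE.
have q_zb: q.-elt zb by rewrite /p_elt oz pnat_id.
have Nzq: z.`_q \in 'N_M(U) by rewrite groupX.
suffices Czq: z.`_q \in 'C_M(U).
  move: (prime_gt1 q_pr); rewrite -oz -(constt_p_elt q_zb) Dzb -morph_constt //.
  by rewrite /= coset_id // order1.
case/setIP: (Nzq) => Mzq _; rewrite inE Mzq (Mloc pU sUM Nzq) //.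
  by apply: pi_pnat (p_elt_constt q z) _; rewrite !inE.
by exists q => //; apply: p_elt_constt.
Qed.

Lemma norm_cent_Sylow (U S : {group gT}) :
    p.-group U -> U \subset M -> p.-Sylow('N_M(U)) S ->
  'C_M(U) * S = 'N_M(U).
Proof.
move=> pU sUM sylS.
have sSN := pHall_sub sylS.
have nCN: 'N_M(U) \subset 'N('C_M(U)).
  by rewrite normsI ?norms_cent ?subsetIr // normsG ?subsetIl.
have sCN: 'C_M(U) \subset 'N_M(U) by rewrite setIS // cent_sub.
have nCS := subset_trans sSN nCN.
have SqN: S / 'C_M(U) = 'N_M(U) / 'C_M(U).
  apply/eqP; rewrite (pHall_id (quotient_pHall nCS sylS)) //.
  exact: pgroup_norm_cent_quotient.
apply/eqP; rewrite eqEsubset mul_subG //=.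
by rewrite -quotientSK // SqN.
Qed.

(** Induction on the index of [D = P :&: Q] in [P]. Normalisers grow in
p-groups, so ['N_P(D)] and ['N_Q(D)] are strictly larger than [D]; they lie in
Sylow subgroups [S] and [T] of ['N_M(D)], and [T = S :^ c] for some [c] in
['C_M(D)] by [norm_cent_Sylow]. Enlarging [S] to a Sylow subgroup [R] of [M], both
[P :&: R] and [R :^ c :&: Q] are larger than [D], and the three conjugating
elements all centralise [D]. *)
Lemma Sylow_conj_cent_cap (P Q : {group gT}) :
    p.-Sylow(M) P -> p.-Sylow(M) Q ->
  exists2 c, c \in 'C_M(P :&: Q) & Q :=: P :^ c.
Proof.
have [n] := ubnP (#|P| - #|P :&: Q|).
elim: n => // n IHn in P Q * => /ltnSE-len sylP sylQ.
have [sPM pP _] := and3P sylP; have [sQM pQ _] := and3P sylQ.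
have oPQ: #|P| = #|Q| by rewrite (card_Hall sylP) (card_Hall sylQ).
have [eqPQ | neqPQ] := eqVneq (gval P) (gval Q).
  by exists 1; rewrite ?group1 // conjsg1.
pose D := (P :&: Q)%G; have sDP: D \subset P := subsetIl _ _.
have sDQ: D \subset Q := subsetIr _ _.
have prDP: D \proper P.
  rewrite properEneq sDP andbT; apply: contraNneq neqPQ => /= eqDP.
  by rewrite eqEcard oPQ leqnn andbT -eqDP subsetIr.
have prDQ: D \proper Q.
  rewrite properEneq sDQ andbT; apply: contraNneq neqPQ => /= eqDQ.
  by rewrite eq_sym eqEcard oPQ leqnn andbT -eqDQ subsetIl.
have pD := pgroupS sDP pP; have sDM := subset_trans sDP sPM.
have sNPN: 'N_P(D) \subset 'N_M(D) by rewrite setSI.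
have sNQN: 'N_Q(D) \subset 'N_M(D) by rewrite setSI.
have [S sylS sNPS] := Sylow_superset sNPN (pgroupS (subsetIl _ _) pP).
have [T sylT sNQT] := Sylow_superset sNQN (pgroupS (subsetIl _ _) pQ).
have [k Nk defT] := Sylow_trans sylS sylT.
have [c Cc defTc]: exists2 c, c \in 'C_M(D) & T :=: S :^ c.
  have{Nk}: k \in 'C_M(D) * S by rewrite (norm_cent_Sylow pD sDM sylS).
  have nCS: S \subset 'N('C_M(D)).
    apply: subset_trans (pHall_sub sylS) _.
    by rewrite normsI ?norms_cent ?subsetIr // normsG ?subsetIl.
  rewrite -normC // => /mulsgP[s c Ss Cc defk]; exists c => //.
  by rewrite defT defk conjsgM (conjGid Ss).
have sSM: S \subset M := subset_trans (pHall_sub sylS) (subsetIl _ _).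
have [R sylR sSR] := Sylow_superset sSM (pHall_pgroup sylS).
have ltDPR: #|D| < #|P :&: R|.
  apply: leq_trans (proper_card (nilpotent_proper_norm (pgroup_nil pP) prDP)) _.
  by apply/subset_leq_card; rewrite subsetI subsetIl (subset_trans sNPS).
have ltDQR: #|D| < #|R :^ c :&: Q|.
  apply: leq_trans (proper_card (nilpotent_proper_norm (pgroup_nil pQ) prDQ)) _.
  apply/subset_leq_card; rewrite subsetI subsetIl andbT.
  by rewrite (subset_trans sNQT) // defTc conjSg.
have Mc: c \in M by case/setIP: Cc.
have sylRc: p.-Sylow(M) (R :^ c)%G by rewrite /= pHallJ.
have ltD: #|D| < #|P| := proper_card prDP.
have{} IHn (P1 Q1 : {group gT}):
    p.-Sylow(M) P1 -> p.-Sylow(M) Q1 -> #|D| < #|P1 :&: Q1| ->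
  exists2 c, c \in 'C_M(P1 :&: Q1) & Q1 :=: P1 :^ c.
- move=> sylP1 sylQ1 ltD1; apply: IHn => //; apply: leq_trans len.
  rewrite (card_Hall sylP1) -(card_Hall sylP).
  exact: ltn_sub2l.
have [x Cx defR] := IHn P R sylP sylR ltDPR.
have [y Cy defQ] := IHn _ Q sylRc sylQ ltDQR.
have sD1: D \subset P :&: R.
  rewrite subsetI sDP (subset_trans _ (subset_trans sNPS sSR)) //.
  by rewrite subsetI sDP normG.
have sD2: D \subset R :^ c :&: Q.
  rewrite subsetI sDQ andbT (subset_trans _ (_ : T \subset R :^ c)) //.
    by rewrite (subset_trans _ sNQT) // subsetI sDQ normG.
  by rewrite defTc conjSg.
exists (x * c * y); last by rewrite defQ /= defR !conjsgM.
by rewrite !groupM // ?(subsetP _ x Cx) ?(subsetP _ y Cy) // setIS ?centS.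
Qed.

(** Both [P] and [P :^ g] contain [x ^ g]. An element [c] centralising their
intersection and carrying [P :^ g] to [P] turns [g] into an element of
['N_M(P) = 'C_M(P) * P] with the same effect on [x]. *)
Lemma Sylow_controls_fusion (P : {group gT}) (x g : gT) :
    p.-Sylow(M) P -> x \in P -> g \in M -> x ^ g \in P ->
  exists2 u, u \in P & x ^ g = x ^ u.
Proof.
move=> sylP Px Mg Pxg; have [sPM pP _] := and3P sylP.
have sylPg: p.-Sylow(M) (P :^ g)%G by rewrite /= pHallJ.
have [c /setIP[Mc Cc] defPg] := Sylow_conj_cent_cap sylPg sylP.
have sylN: p.-Sylow('N_M(P)) P.
  by apply: pHall_subl sylP; rewrite ?subsetIl // subsetI sPM normG.
have: g * c \in 'C_M(P) * P.
  by rewrite (norm_cent_Sylow pP sPM sylN) !inE groupM //= conjsgM -defPg.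
case/mulsgP=> [d u /setIP[_ cPd] Pu defgc]; exists u => //.
have <-: (x ^ g) ^ c = x ^ g.
  apply/conjg_fixP/commgP/commute_sym/(centP Cc).
  by apply/setIP; rewrite /= memJ_conjg.
rewrite -conjgM defgc conjgM; congr (_ ^ u).
by apply/conjg_fixP/commgP/commute_sym/(centP cPd).
Qed.

End Fusion.

(** * Transfer *)

Section Transfer.
Import GRing.Theory FinRing.Theory.

(** If [M] is perfect then its transfer to the abelian group [P / P'] is
trivial. By control of fusion its value at [g] in [P] is the class of
[g ^+ #|M : P|], and [#|M : P|] is prime to [p], so [P = P'] and hence [P = 1]
by nilpotency. *)
Lemma p_locally_central_not_perfect (p : nat) (gT : finGroupType)
    (M : {group gT}) :
    prime p -> p %| #|M| -> p_locally_central p M -> M^`(1) != M.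
Proof.
move=> p_pr pM Mloc; apply/eqP=> perfM.
have [P sylP] := Sylow_exists p M; have [sPM pP _] := and3P sylP.
pose alpha := restrm_morphism (der_norm 1 P) (coset_morphism P^`(1)).
have abA: abelian (alpha @* P).
  by rewrite morphim_restrm setIid; apply: sub_der1_abelian.
suffices sPP': P \subset P^`(1).
  have ntP: P :!=: 1.
    apply/eqP=> P1; have /esym/eqP := card_Hall sylP.
    by rewrite P1 cards1 p_part_eq1 mem_primes p_pr pM cardG_gt0.
  have := sol_der1_proper (nilpotent_sol (pgroup_nil pP)) (subxx P) ntP.
  by rewrite properE sPP' andbF.
apply/subsetP=> g Pg; have Mg := subsetP sPM g Pg.
have V0: transfer M abA g = 0%R.
  have: transfer M abA g \in (transfer_morphism M abA) @* M^`(1).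
    by rewrite perfM mem_morphim.
  have V'1: (transfer_morphism M abA @* M)^`(1) = 1.
    by apply/derG1P; apply: zmod_abelian.
  by rewrite morphim_der // V'1 => /set1P.
have trX := transversalP (rcosets_cycle_partition sPM Mg).
set X := transversal _ _ in trX.
have Vg := transfer_cycle_expansion sPM abA Mg trX.
have nP'P: P \subset 'N(P^`(1)) := der_norm 1 P.
have key x : x \in X ->
    restrm (transfer_morph_subproof alpha) (FiniteModule.fmod abA \o alpha)
      ((g ^+ #|<[g]> : P :* x|) ^ x^-1)
    = (FiniteModule.fmod abA (alpha g) *+ #|<[g]> : P :* x|)%R.
- move=> Xx; set n := #|_ : _|.
  have Mx: x^-1 \in M by rewrite groupV (subsetP (transversal_sub trX)).
  have Pgx: (g ^+ n) ^ x^-1 \in P.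
    rewrite conjgE invgK mulgA -mem_rcoset.
    exact: mulg_exp_card_rcosets.
  have [u Pu ->] := Sylow_controls_fusion Mloc sylP (groupX n Pg) Mx Pgx.
  rewrite /restrm /= -FiniteModule.fmodX ?mem_morphim //.
  congr (FiniteModule.fmod _ _).
  have Aa: alpha (g ^+ n) \in alpha @* P by rewrite mem_morphim ?groupX.
  have Au: alpha u \in alpha @* P by rewrite mem_morphim.
  rewrite (morphJ alpha) ?groupX //.
  rewrite -(morphX alpha) //; apply/conjg_fixP/commgP.
  exact: (centsP abA).
have{} V0: alpha g ^+ #|M : P| = 1.
  have Aag: alpha g \in alpha @* P by rewrite mem_morphim.
  rewrite -(FiniteModule.fmodK abA (groupX #|M : P| Aag)) FiniteModule.fmodX //.
  rewrite -(sum_index_rcosets_cycle sPM Mg trX) -sumrMnr -(eq_bigr _ key) -Vg V0.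
  exact: FiniteModule.fmval0.
apply: coset_idr; first exact: subsetP nP'P g Pg.
have p_ag: p.-elt (alpha g) by apply: morph_p_elt => //; apply: mem_p_elt pP Pg.
have p'i: p^'.-nat #|M : P| by case/and3P: sylP.
apply/eqP; rewrite -order_eq1; apply/eqP/(pnat_1 p_ag)/(pnat_dvd _ p'i).
by rewrite order_dvdn V0.
Qed.
End Transfer.

(** * Class products and minimal normal subgroups *)

Section ClassProducts.

Variable p : nat.

Definition class_product_is_class (gT : finGroupType) (G : {group gT}) :=
  forall x y : gT, x \in G -> y \in G ->
    p.-elt x -> p^'.-elt y -> prime_power_order y ->
    x ^: G * y ^: G = (x * y) ^: G.

(** If [d] is conjugate to [x] and [v] to [y], then [v * d = d ^ v^-1 * v] lies
in the class product; so right translation by [d] preserves the class of [y],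
and the elements with this property form a group. *)
Lemma class_absorbs_normal_closure (gT : finGroupType) (G : {group gT})
    (x y c : gT) :
    x ^: G * y ^: G = y ^: G -> y \in G -> c \in <<x ^: G>> ->
  y * c \in y ^: G.
Proof.
move=> xyG Gy; suffices sxN: <<x ^: G>> \subset 'N(y ^: G | 'R).
  move=> /(subsetP sxN) Nc.
  by rewrite -[y * c]/('R%act y c) (astabs_act _ Nc) class_refl.
rewrite gen_subG; apply/subsetP=> d xGd; rewrite !inE; apply/subsetP=> v yGv.
have Gv: v \in G by apply: subsetP yGv; rewrite class_subG.
rewrite inE /= -xyG (_ : v * d = d ^ v^-1 * v).
  have [g Gg ->] := imsetP xGd.
  by rewrite mem_mulg // -conjgM memJ_class ?groupM ?groupV.
by rewrite conjgE invgK -!mulgA mulVg mulg1.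
Qed.

(** The heart of the argument: a failure of [p_locally_central] inside [M]
produces [x <> 1] and [y] in [M] with [x ^: G * y ^: G = y ^: G]; since [x]
generates [M] as a normal subgroup, [y^-1] may be absorbed, which puts [1] in
the class of [y]. *)
Lemma minnormal_abelian_or_p' (gT : finGroupType) (G M : {group gT}) :
    prime p -> class_product_is_class G -> minnormal M G -> M \subset G ->
  abelian M \/ ~~ (p %| #|M|).
Proof.
move=> p_pr Gcl minM sMG.
have [/andP[ntM nMG] minMG] := mingroupP minM.
have [pM | ] := boolP (p %| #|M|); [left | by right].
have [/derG1P // | ntM'] := eqVneq M^`(1) 1.
have perfM: M^`(1) = M.
  apply: minMG; last exact: der_sub.
  by rewrite ntM' (char_norm_trans (der_char 1 M)).
suffices Mloc: p_locally_central p M.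
  by have /eqP[] := p_locally_central_not_perfect p_pr pM Mloc.
move=> U y pU sUM Ny p'y ppy.
have [My nUy] := setIP Ny.
apply/centP=> u Uu; pose x := [~ u, y^-1].
have [/eqP/commgP cuy | ntx] := eqVneq x 1.
  by apply: commute_sym; rewrite -[y]invgK; apply: commuteV.
have Ux: x \in U by rewrite /x commgEl groupM ?groupV // memJ_norm ?groupV.
have xy: x * y = y ^ u.
  by rewrite /x commgEr conjgE invgK -!mulgA mulVg mulg1.
have Gx := subsetP sMG x (subsetP sUM x Ux).
have Gy := subsetP sMG y My.
have Gu := subsetP sMG u (subsetP sUM u Uu).
have xyG: x ^: G * y ^: G = y ^: G.
  by rewrite Gcl ?(mem_p_elt pU Ux) // xy classGidl.
have defM: <<x ^: G>> = M.
  apply: (minMG <<x ^: G>>%G).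
    rewrite norms_gen ?class_norm // andbT.
    apply: contraNneq ntx => xG1.
    have: x \in <<x ^: G>> by rewrite mem_gen ?class_refl.
    by rewrite [<<_>>]xG1 => /set1P/eqP.
  by rewrite gen_subG class_sub_norm // (subsetP sUM).
have: y * y^-1 \in y ^: G.
  apply: class_absorbs_normal_closure xyG Gy _.
  by rewrite defM groupV.
rewrite mulgV => /imsetP[g _ /esym/eqP]; rewrite conjg_eq1 => /eqP y1.
by case/eqP: ntx; rewrite /x y1 invg1 commg1.
Qed.

End ClassProducts.

(** * Chief factors and composition factors *)

Section Quotients.

Variable p : nat.

(** The pi-part of any lift of a pi-element of [G / N] is still a lift of it, so
pi-elements of [G / N] come from pi-elements of [G]. *)
Lemma class_product_is_class_quotient (gT : finGroupType) (G N : {group gT}) :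
  N <| G -> class_product_is_class p G -> class_product_is_class p (G / N).
Proof.
move=> nsNG Gcl xb yb Gxb Gyb px p'y [q q_pr qy].
have nNG := normal_norm nsNG.
have lift pi zb : zb \in G / N -> pi.-elt zb ->
    exists z, [/\ z \in G, pi.-elt z & zb = coset N z].
  move=> /morphimP[z Nz Gz ->] pi_z; exists z.`_pi; split.
  - exact: groupX.
  - exact: p_elt_constt.
  by rewrite (morph_constt (coset_morphism N)) // constt_p_elt.
have [x [Gx p_x ->]] := lift _ _ Gxb px.
have [y0 [Gy0 q_y0 Dyb]] := lift _ _ Gyb qy.
(* For [yb = 1] nothing prevents [q = p], so [y0] need not be a p'-element. *)
have [yb1 | ntyb] := eqVneq yb 1.
  by rewrite yb1 mulg1 class1G mulg1.
have p'q: q \in p^'.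
  apply: contraR ntyb; rewrite !inE negbK => /eqP eq_qp.
  by rewrite -order_eq1 (pnat_1 qy) // eq_qp.
have p'y0: p^'.-elt y0 := pi_pnat q_y0 p'q.
have ppy0: prime_power_order y0 by exists q.
have GyG z : z \in G -> z ^: G \subset 'N(N).
  by move=> Gz; rewrite (subset_trans _ nNG) // class_subG.
rewrite Dyb -morphM ?(subsetP nNG) //=.
rewrite -!quotient_class ?(subsetP nNG) ?groupM // -quotientMl ?GyG //.
by rewrite Gcl.
Qed.

(** Take [N] maximal among the normal subgroups of [G] with [N :&: H] inside
[K], and [M / N] minimal normal in [G / N]. Then [M :&: H] is not inside [K],
so by simplicity it covers [H / K], while [N :&: H] vanishes in it: thus
[H / K] is a quotient of a subgroup of the chief factor [M / N]. *)
Lemma simple_section_abelian_or_p' (gT : finGroupType) (G H K : {group gT}) :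
    prime p -> class_product_is_class p G -> H \subset G -> K <| H ->
    simple (H / K) ->
  abelian (H / K) \/ ~~ (p %| #|H / K|).
Proof.
move=> p_pr Gcl sHG nsKH simHK.
have [sKH nKH] := andP nsKH.
pose gP (N : {group gT}) := (N <| G) && (N :&: H \subset K).
have [|N /maxgroupP[/andP[nsNG sNHK] maxN] _] := @maxgroup_exists _ gP 1%G.
  by rewrite /gP normal1 subIset // sub1G.
have nNG := normal_norm nsNG.
have ntGN: G / N != 1.
  apply: contraTneq simHK => /trivgP GN1; apply/negP=> /simpleP[ntHK _].
  case/eqP: ntHK; apply: quotientS1; apply: subset_trans sNHK.
  rewrite subsetI subxx andbT (subset_trans sHG) //.
  by rewrite -quotient_sub1.
have [|Mb minMb sMbG] := @mingroup_exists _
  (fun M => (M :!=: 1) && (G / N \subset 'N(M))) (G / N)%G.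
  by rewrite ntGN normG.
have [/andP[ntMb nMbG] _] := mingroupP minMb.
have nsMbG: Mb <| G / N by apply/andP.
have [M defMb sNM nsMG] := inv_quotientN nsNG nsMbG.
have nsMHH: M :&: H <| H by rewrite setIC (normalGI sHG).
have [sMG nMG] := andP nsMG.
have sMHH := normal_sub nsMHH.
have sMHK: ~~ (M :&: H \subset K).
  apply: contra ntMb => sMHK.
  rewrite defMb (maxN M) ?trivg_quotient //.
  by rewrite /gP nsMG.
have defHK: (M :&: H) / K = H / K.
  case/simpleP: simHK => _ /(_ ((M :&: H) / K)%G)[|/= MHK1|//].
    exact: quotient_normal.
  case/negP: sMHK; rewrite -quotient_sub1 ?MHK1 //.
  exact: subset_trans nKH.
have nNMH: M :&: H \subset 'N(N).
  by rewrite subIset // (subset_trans sMG).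
pose A := ((M :&: H) / N)%G.
have sAM: A \subset Mb by rewrite defMb quotientS ?subsetIl.
have GNcl := class_product_is_class_quotient nsNG Gcl.
have [abM | p'M] := minnormal_abelian_or_p' p_pr GNcl minMb sMbG.
  left; rewrite -defHK; apply: sub_der1_abelian.
  have sX'N: (M :&: H)^`(1) \subset N.
    by apply: der1_min nNMH _; apply: abelianS sAM abM.
  apply: subset_trans sNHK; rewrite subsetI sX'N.
  exact: subset_trans (der_sub 1 _) sMHH.
right; apply: contra p'M => pHK; apply: dvdn_trans (cardSg sAM).
apply: dvdn_trans pHK _.
rewrite -defHK !card_quotient ?(subset_trans sMHH nKH) //.
rewrite -[#|_ : K|]indexgI -[#|_ : N|]indexgI; apply: indexgS.
rewrite subsetI subsetIl; apply: subset_trans sNHK.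
by rewrite subsetI subsetIr (subset_trans (subsetIl _ _) sMHH).
Qed.

(** Entries of [mkfactors] are representatives of isomorphism classes; this
recovers the sections of [G] that they represent. *)
Lemma composition_factor_section (gT : finGroupType) (G : {group gT})
    (s : seq {group gT}) (F : section gT) :
    comps G s -> F \in mkfactors G s ->
  exists H K : {group gT}, [/\ H \subset G, K <| H, simple (H / K) &
    F \isog (H / K)].
Proof.
elim: s G => //= H s IHs G cGHs; rewrite /mkfactors /= inE.
have /compsP[_ /= /andP[maxH _]] := cGHs.
have nsHG := maxnormal_normal maxH.
case/orP=> [/eqP-> | Fs].
  exists G, H; split=> //; first by rewrite quotient_simple.
  exact: (section_reprP (mkSec G H)).
have [H1 [K [sH1H nsK simHK isoF]]] := IHs H (comps_cons cGHs) Fs.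
by exists H1, K; split=> //; apply: subset_trans sH1H (normal_sub nsHG).
Qed.

End Quotients.

Theorem theorem2p5 (gT : finGroupType) (G : {group gT}) (p : nat)
    (p_pr : prime p)
    (hcl : forall x y : gT, x \in G -> y \in G ->
       p.-elt x -> p^'.-elt y -> prime_power_order y ->
       x ^: G * y ^: G = (x * y) ^: G) :
  p_solvable p G.
Proof.
move=> s compGs F /(composition_factor_section compGs).
case=> H [K [sHG nsKH simHK isoF]]; rewrite (card_isog isoF).
have [abHK | ] := simple_section_abelian_or_p' p_pr hcl sHG nsKH simHK;
  last by right.
have [pHK | ] := boolP (p %| #|H / K|); last by right.
left; have := simple_sol_prime (abelian_sol abHK) simHK.
by move=> HK_pr; apply/esym/eqP; rewrite -(dvdn_prime2 p_pr).
Qed.
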